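(* Let $M \subseteq H^2(\mathbb{D},\mathbb{C}^n)$ be a closed subspace that is nearly $S^*$-invariant with a finite-dimensional defect space $D$. Let $W = M \ominus (M \cap zH^2(\mathbb{D},\mathbb{C}^n))$, let $r = \dim W$ (one has $r \le n$), and let $W_1,\dots,W_r$ be an orthonormal basis of $W$. Then for any $i \in \{1,\dots,n\}$, the (not necessarily closed) subspace $M_i := P_i(M) \subseteq H^2(\mathbb{D},\mathbb{C}^i)$ is nearly $S^*$-invariant with defect space $$\left(\frac{\operatorname{span}\{P_i(W_1),\dots,P_i(W_r)\}}{z} \cap H^2(\mathbb{D},\mathbb{C}^i)\right) + P_i(D).$$
   Context: $H^2(\mathbb{D},\mathbb{C}^n)$ is the Hilbert space of column vectors of length $n$ with entries in the Hardy space $H^2$ of the unit disc $\mathbb{D}$. The backward shift is $S^*F(z) = (F(z)-F(0))/z$ (entrywise). A closed subspace $M \subseteq H^2(\mathbb{D},\mathbb{C}^n)$ is nearly $S^*$-invariant with defect $m$ if there is an $m$-dimensional subspace $D$ (a defect space, which may be taken orthogonal to $M$) such that whenever $f \in M$ and $f(0)=0$ one has $S^*f \in M \oplus D$. For a not necessarily closed subspace $N$, saying that $N$ is nearly $S^*$-invariant with a defect space $E$ means that $E$ is a finite-dimensional subspace and $S^*f \in N + E$ whenever $f \in N$ and $f(0)=0$. $P_i : H^2(\mathbb{D},\mathbb{C}^n) \to H^2(\mathbb{D},\mathbb{C}^i)$ is the projection onto the first $i$ coordinates. The set $\frac{\operatorname{span}\{\cdot\}}{z} \cap H^2(\mathbb{D},\mathbb{C}^i)$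 consists of the functions $h/z$, with $h$ in the span, that lie in $H^2(\mathbb{D},\mathbb{C}^i)$. If $W=\{0\}$ (i.e. all functions in $M$ vanish at $0$), this set is interpreted as $\{0\}$. *)

(* Defs.v *)
From HB Require Import structures.
From mathcomp Require Import all_boot all_order all_algebra.
From mathcomp Require Import complex.
From mathcomp Require Import all_classical all_reals all_analysis.

Set Implicit Arguments.
Unset Strict Implicit.
Unset Printing Implicit Defensive.

Import Order.TTheory GRing.Theory Num.Theory.
Import numFieldNormedType.Exports.

Local Open Scope classical_set_scope.
Local Open Scope ring_scope.

(* [R[i]^o] is [R[i]] with the topology of the modulus; it is used wherever a
   limit is taken. *)

Definition disc (R : realType) := {z : R[i] | `|z| < 1}.

Definition disc0 {R : realType} : disc R :=
  exist (fun z : R[i] => `|z| < 1) 0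
    (eq_ind_r (fun x : R[i] => x < 1) ltr01 (normr0 R[i])).

Section Hardy.
Variable R : realType.

Definition is_taylor (f : disc R -> R[i]) (a : nat -> R[i]) : Prop :=
  forall z : disc R,
    (series (fun k => a k * val z ^+ k) : nat -> R[i]^o) @ \oo --> (f z : R[i]^o).

(* The Hardy space H^2: sums on the disc of power series with square summable
   coefficients. *)
Definition hardy1 : set (disc R -> R[i]) :=
  [set f | exists a : nat -> R[i], is_taylor f a /\
     cvgn (series (fun k => complex.Re `|a k| ^+ 2) : nat -> R)].

(* By uniqueness of power series expansions, the choice made by [xget] is
   irrelevant as soon as [f] is the sum of a power series. *)
Definition taylor (f : disc R -> R[i]) : nat -> R[i] := xget 0 (is_taylor f).

Definition hardy1_dot (f g : disc R -> R[i]) : R[i] :=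
  limn (series (fun k => taylor f k * (taylor g k)^*) : nat -> R[i]^o).

Section Vectorial.
Variable n : nat.
Implicit Types (F G : disc R -> 'cV[R[i]]_n) (M N D S : set (disc R -> 'cV[R[i]]_n)).

Definition entry F (j : 'I_n) : disc R -> R[i] := fun z => F z j 0.

Definition hardy : set (disc R -> 'cV[R[i]]_n) :=
  [set F | forall j, hardy1 (entry F j)].

Definition hardy_dot F G : R[i] := \sum_(j < n) hardy1_dot (entry F j) (entry G j).

Definition hardy_norm F : R := Num.sqrt (complex.Re (hardy_dot F F)).

(* S^*F(z) = (F(z) - F(0)) / z; the value at the removable singularity z = 0 is
   F'(0), the vector of Taylor coefficients of order 1. *)
Definition bshift F : disc R -> 'cV[R[i]]_n := fun z =>
  if val z == 0 then \col_j taylor (entry F j) 1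
  else (val z)^-1 *: (F z - F disc0).

Definition mulz F : disc R -> 'cV[R[i]]_n := fun z => val z *: F z.

Definition zhardy : set (disc R -> 'cV[R[i]]_n) := mulz @` hardy.

(* (S / z) \cap H^2(D, C^n), the value at 0 being filled in by membership in
   H^2. *)
Definition divz_hardy S : set (disc R -> 'cV[R[i]]_n) :=
  [set G | hardy G /\
     exists2 h, S h & forall z, val z != 0 -> G z = (val z)^-1 *: h z].

Definition is_subspace M : Prop :=
  [/\ M `<=` hardy, M 0 &
      forall (c : R[i]) F G, M F -> M G -> M (c *: F + G)].

Definition closed_subspace M : Prop :=
  is_subspace M /\
  forall F, hardy F ->
    (forall e : R, 0 < e -> exists2 G, M G & hardy_norm (F - G) < e) -> M F.

Definition lin_span (r : nat) (v : 'I_r -> (disc R -> 'cV[R[i]]_n)) :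
    set (disc R -> 'cV[R[i]]_n) :=
  [set F | exists c : 'I_r -> R[i], F = \sum_(k < r) c k *: v k].

Definition lin_indep (r : nat) (v : 'I_r -> (disc R -> 'cV[R[i]]_n)) : Prop :=
  forall c : 'I_r -> R[i], \sum_(k < r) c k *: v k = 0 -> forall k, c k = 0.

Definition has_dim D (m : nat) : Prop :=
  exists v : 'I_m -> (disc R -> 'cV[R[i]]_n), lin_indep v /\ D = lin_span v.

Definition sumspace M N : set (disc R -> 'cV[R[i]]_n) :=
  [set F + G | F in M & G in N].

Definition ominus M N : set (disc R -> 'cV[R[i]]_n) :=
  [set F | M F /\ forall G, N G -> hardy_dot F G = 0].

Definition orthonormal_basis M (r : nat)
    (v : 'I_r -> (disc R -> 'cV[R[i]]_n)) : Prop :=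
  (forall j k, hardy_dot (v j) (v k) = (j == k)%:R) /\ M = lin_span v.

(* The direct sum in the definition for closed subspaces is algebraic:
   orthogonality of [D] to [M] is not required. *)
Definition nearly_invariant_defect M (m : nat) D : Prop :=
  [/\ closed_subspace M, is_subspace D, has_dim D m, M `&` D = [set 0] &
      forall F, M F -> F disc0 = 0 -> sumspace M D (bshift F)].

Definition nearly_invariant_with N E : Prop :=
  [/\ is_subspace N, is_subspace E, exists m, has_dim E m &
      forall F, N F -> F disc0 = 0 -> sumspace N E (bshift F)].

End Vectorial.

Definition first_coords (n i : nat) (hi : (i <= n)%N) (F : disc R -> 'cV[R[i]]_n) :
    disc R -> 'cV[R[i]]_i :=
  fun z => rowsub (widen_ord hi) (F z).

End Hardy.

Arguments hardy {R} n.
Arguments zhardy {R} n.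

(* Main.v *)
Require Import Defs.
From mathcomp Require Import all_boot all_order all_algebra.
From mathcomp Require Import complex.
From mathcomp Require Import all_classical all_reals all_analysis.
From mathcomp Require Import ring lra.

Import Order.TTheory GRing.Theory Num.Theory.
Import numFieldNormedType.Exports.

Local Open Scope classical_set_scope.
Local Open Scope ring_scope.

Set Implicit Arguments.
Unset Strict Implicit.
Unset Printing Implicit Defensive.

(** Let [M0] be the functions of [M] that vanish at 0; by [zhardyP] it is the
    intersection of [M] with [zhardy n], so [W] is the orthogonal complement of
    [M0] in [M].  Everything rests on the decomposition [F = w + g] of an
    element of [M] with [w] in [W] and [g] in [M0] ([orth_decomp]).  If
    [P_i F] vanishes at 0, then so does [P_i w], because [g] does; by linearity
    [S^* (P_i F) = S^* (P_i w) + P_i (S^* g)].  The first summand is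
    [P_i w / z], which lies in the quotient of the span of the [P_i W_k] by [z],
    and near invariance of [M] puts [S^* g] in [M + D], hence the second
    summand in [P_i M + P_i D].

    The decomposition is where Hilbert space theory enters.  The component [w]
    is the element of least norm of [M] having the same value at 0 as [F]: a
    minimizing sequence is Cauchy by the parallelogram law
    ([sqnorm_parallelogram]), it converges because H^2 is complete
    ([hardy_complete]), the limit is in [M] because [M] is closed, it has the
    right value at 0 because evaluation at 0 is bounded ([sqmod_disc0_le]), and
    minimality gives orthogonality to [M0] ([sqmod_dot_le]).

    Since the inner product of H^2 is a series in Taylor coefficients, all this
    needs those coefficients to be determined by the function
    ([is_taylor_unique_off0]), after which H^2 is handled as the space [l2] of
    square summable sequences.

    Finite dimensionality comes from coordinates ([lin_indep_le_coord]).  An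
    element of [W] is determined by its value at 0 ([ominus_disc0_inj]), so
    independent families in [W], in particular orthonormal ones, have at most
    [n] members; a maximal orthonormal family is then a basis
    ([orthonormal_basis_exists]).  Likewise an element [G + P_i D'] of the
    defect space is determined by the coefficients of [zG] and of [D']
    ([dim_le_defect]). *)

(** * Complex numbers and complex limits *)

(** Squared moduli are used instead of moduli throughout: they are real valued
    and polynomial in the real and imaginary parts ([sqmodE]). *)
Definition sqmod {R : realType} (z : R[i]) : R := complex.Re `|z| ^+ 2.

Lemma sqmodE (R : realType) (z : R[i]) :
  sqmod z = complex.Re z ^+ 2 + complex.Im z ^+ 2.
Proof. by rewrite /sqmod normc_def /= sqr_sqrtr// addr_ge0 ?sqr_ge0. Qed.

Lemma sqmod_ge0 (R : realType) (z : R[i]) : 0 <= sqmod z.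
Proof. exact: sqr_ge0. Qed.

Lemma sqmod0 (R : realType) : sqmod (0 : R[i]) = 0.
Proof. by rewrite sqmodE /= expr0n addr0. Qed.

Lemma sqmod_eq0 (R : realType) (z : R[i]) : sqmod z = 0 -> z = 0.
Proof.
case: z => x y; rewrite sqmodE /= => h.
have x0 : x = 0 by nra.
have y0 : y = 0 by nra.
by rewrite x0 y0.
Qed.

Lemma sqmodM (R : realType) (z w : R[i]) : sqmod (z * w) = sqmod z * sqmod w.
Proof. by case: z w => [x y] [x' y']; rewrite !sqmodE /=; ring. Qed.

Lemma sqmodX (R : realType) (z : R[i]) k : sqmod (z ^+ k) = sqmod z ^+ k.
Proof.
elim: k => [|k IH]; last by rewrite !exprS sqmodM IH.
by rewrite !expr0 sqmodE /=; ring.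
Qed.

Lemma sqmodJ (R : realType) (z : R[i]) : sqmod z^* = sqmod z.
Proof. by case: z => x y; rewrite !sqmodE /=; ring. Qed.

Lemma sqmodN (R : realType) (z : R[i]) : sqmod (- z) = sqmod z.
Proof. by case: z => x y; rewrite !sqmodE /=; ring. Qed.

Lemma sqmodD_le (R : realType) (z w : R[i]) :
  sqmod (z + w) <= 2 * sqmod z + 2 * sqmod w.
Proof.
case: z w => [x y] [x' y']; rewrite !sqmodE /=.
by have := sqr_ge0 (x - x'); have := sqr_ge0 (y - y'); nra.
Qed.

Lemma mul_le_sqrD (R : realType) (x y : R) :
  0 <= x -> 0 <= y -> x * y <= (x + y) ^+ 2.
Proof. by move=> x0 y0; nra. Qed.

Lemma mulJ_sqmod (R : realType) (z : R[i]) : z * z^* = (sqmod z)%:C%C.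
Proof.
case: z => x y; rewrite sqmodE /=; apply/eqP; rewrite eq_complex /=.
by apply/andP; split; apply/eqP; ring.
Qed.

Lemma norm_lt_sqmod (R : realType) (z : R[i]) (e : R) : 0 < e ->
  (`|z| < e%:C%C) = (sqmod z < e ^+ 2).
Proof.
move=> e0; rewrite ltcE normc_def /= eqxx /= sqmodE.
set s := _ + _; have s0 : 0 <= s by rewrite addr_ge0 ?sqr_ge0.
by rewrite -[in RHS](sqr_sqrtr s0) ltr_pXn2r// nnegrE ?sqrtr_ge0 ?ltW.
Qed.

Lemma sqmod_disc (R : realType) (z : disc R) : sqmod (val z) < 1.
Proof. by have := valP z; rewrite /= (norm_lt_sqmod _ ltr01) expr1n. Qed.

Lemma gtc0E (R : realType) (e : R[i]) : 0 < e ->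
  0 < complex.Re e /\ e = (complex.Re e)%:C%C.
Proof. by case: e => x y; rewrite ltcE /= => /andP[/eqP -> ->]. Qed.

(** Convergence in [R[i]^o] is wrapped up as a predicate on sequences of [R[i]],
    so that limits are computed from real and imaginary parts ([ccvgP]). *)
Definition ccvg {R : realType} (u : nat -> R[i]) (l : R[i]) : Prop :=
  (u : nat -> R[i]^o) @ \oo --> (l : R[i]^o).

Lemma ccvgP (R : realType) (u : nat -> R[i]) (l : R[i]) :
  ccvg u l <->
  ((fun n => complex.Re (u n)) @ \oo --> complex.Re l /\
   (fun n => complex.Im (u n)) @ \oo --> complex.Im l).
Proof.
split=> [/cvgrPdist_lt ul|[/cvgrPdist_lt ur /cvgrPdist_lt ui]].
  split; apply/cvgrPdist_lt => e e0.
    have e0' : 0 < e%:C%C :> R[i] by rewrite ltcE /= eqxx.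
    have /= := ul _ e0'; apply: filterS => n.
    rewrite norm_lt_sqmod// sqmodE => h.
    rewrite -(ltr_pXn2r (n := 2))// ?nnegrE ?ltW//.
    rewrite real_normK ?num_real//; move: h; case: (l) (u n) => [a b] [c d] /=.
    by have := sqr_ge0 (b - d); nra.
  have e0' : 0 < e%:C%C :> R[i] by rewrite ltcE /= eqxx.
  have /= := ul _ e0'; apply: filterS => n.
  rewrite norm_lt_sqmod// sqmodE => h.
  rewrite -(ltr_pXn2r (n := 2))// ?nnegrE ?ltW//.
  rewrite real_normK ?num_real//; move: h; case: (l) (u n) => [a b] [c d] /=.
  by have := sqr_ge0 (a - c); nra.
apply/cvgrPdist_lt => e /gtc0E[e0 ->].
have e2 : 0 < complex.Re e / 2 by rewrite divr_gt0.
have := ur _ e2; have := ui _ e2; apply: filterS2 => n /= h1 h2.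
rewrite norm_lt_sqmod// sqmodE.
have sq (x : R) : `|x| < complex.Re e / 2 -> x ^+ 2 < (complex.Re e / 2) ^+ 2.
  by move=> h; rewrite -real_normK ?num_real// ltr_pXn2r// nnegrE ltW.
move: h1 h2; case: (l) (u n) => [a b] [c d] /= /sq ? /sq ?; nra.
Qed.

Lemma cvgn_ext (T : topologicalType) (u v : nat -> T) (l : T) :
  u =1 v -> u @ \oo --> l -> v @ \oo --> l.
Proof. by move=> /funext ->. Qed.

Lemma ccvg_unique (R : realType) (u : nat -> R[i]) (a b : R[i]) :
  ccvg u a -> ccvg u b -> a = b.
Proof. by move=> ua ub; exact: (cvg_unique _ ua ub). Qed.

Lemma ccvg_lim (R : realType) (u : nat -> R[i]) (l : R[i]) :
  ccvg u l -> limn (u : nat -> R[i]^o) = l.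
Proof. by move=> ul; apply: cvg_lim => //; exact: norm_hausdorff. Qed.

Lemma ccvg_ext (R : realType) (u v : nat -> R[i]) (l : R[i]) :
  u =1 v -> ccvg u l -> ccvg v l.
Proof. by move=> /funext ->. Qed.

Lemma ccvg_cst (R : realType) (c : R[i]) : ccvg (fun=> c) c.
Proof. by apply/ccvgP; split; exact: cvg_cst. Qed.

Lemma ccvg_comb (R : realType) (c : R[i]) (u v : nat -> R[i]) (a b : R[i]) :
  ccvg u a -> ccvg v b -> ccvg (fun n => c * u n + v n) (c * a + b).
Proof.
move=> /ccvgP[ur ui] /ccvgP[vr vi]; apply/ccvgP.
have comb (x y : R) (f g h : nat -> R) (l l' m : R) :
    f @ \oo --> l -> g @ \oo --> l' -> h @ \oo --> m ->
    (fun n => x * f n + y * g n + h n) @ \oo --> x * l + y * l' + m.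
  move=> fl gl hm; apply: cvgD => //.
  by apply: cvgD; apply: cvgM => //; exact: cvg_cst.
case: c a b ur ui vr vi => [x y] [p q] [s t] ur ui vr vi; split.
  have := comb x (- y) _ _ _ _ _ _ ur ui vr; rewrite mulNr /=; apply: cvgn_ext => n.
  by rewrite mulNr; case: (u n) (v n) => [? ?] [? ?].
have := comb x y _ _ _ _ _ _ ui ur vi; rewrite /=; apply: cvgn_ext => n.
by case: (u n) (v n) => [? ?] [? ?].
Qed.

Lemma ccvgJ (R : realType) (u : nat -> R[i]) (a : R[i]) :
  ccvg u a -> ccvg (fun n => (u n)^*) a^*.
Proof.
move=> /ccvgP[ur ui]; apply/ccvgP; split; case: a ur ui => p q ur ui.
  by move: ur; apply: cvgn_ext => n; case: (u n).
have -> : (fun n => complex.Im (u n)^*) = - (fun n => complex.Im (u n)).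
  by apply/funext => n; rewrite fctE; case: (u n).
exact: cvgN.
Qed.

Lemma Re_series (R : realType) (u : nat -> R[i]) n :
  complex.Re (series u n) = series (fun k => complex.Re (u k)) n.
Proof.
rewrite /series /=.
apply: (big_ind2 (fun (x : R[i]) y => complex.Re x = y)) => // -[a b] x [c d] y /=.
by move=> -> ->.
Qed.

Lemma Im_series (R : realType) (u : nat -> R[i]) n :
  complex.Im (series u n) = series (fun k => complex.Im (u k)) n.
Proof.
rewrite /series /=.
apply: (big_ind2 (fun (x : R[i]) y => complex.Im x = y)) => // -[a b] x [c d] y /=.
by move=> -> ->.
Qed.

Lemma ccvg_seriesP (R : realType) (u : nat -> R[i]) (l : R[i]) :
  ccvg (series u) l <->
  (series (fun k => complex.Re (u k)) @ \oo --> complex.Re l /\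
   series (fun k => complex.Im (u k)) @ \oo --> complex.Im l).
Proof.
have := ccvgP (series u) l.
have -> : (fun n => complex.Re (series u n)) = series (fun k => complex.Re (u k)).
  by apply/funext => n; rewrite Re_series.
have -> // : (fun n => complex.Im (series u n)) = series (fun k => complex.Im (u k)).
by apply/funext => n; rewrite Im_series.
Qed.

(** Absolute convergence for complex series; it is what makes both power series
    with [l2] coefficients and the series of the inner product converge. *)
Lemma dominated_series_cvg (R : realType) (u : nat -> R[i]) (v : nat -> R) :
  (forall k, 0 <= v k) -> (forall k, sqmod (u k) <= v k ^+ 2) ->
  cvgn (series v) ->
  exists l, ccvg (series u) l.
Proof.
move=> v0 uv cv.
have key (w : nat -> R) : (forall k, w k ^+ 2 <= sqmod (u k)) -> cvgn (series w).
  move=> wu; apply: normed_cvg; apply: series_le_cvg cv => //= k.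
  rewrite -(ler_pXn2r (n := 2))// ?nnegrE// real_normK ?num_real//.
  exact: le_trans (wu k) (uv k).
have cr : cvgn (series (fun k => complex.Re (u k))).
  by apply: key => k; rewrite sqmodE lerDl sqr_ge0.
have ci : cvgn (series (fun k => complex.Im (u k))).
  by apply: key => k; rewrite sqmodE lerDr sqr_ge0.
exists (limn (series (fun k => complex.Re (u k))) +i*
        limn (series (fun k => complex.Im (u k))))%C.
by apply/ccvg_seriesP.
Qed.

Lemma seriesSl (V : zmodType) (u : nat -> V) n :
  series u n.+1 = u 0%N + series (fun k => u k.+1) n.
Proof. by rewrite /series /= big_nat_recl. Qed.

Lemma cvg_seriesSl (K : numFieldType) (V : normedModType K) (u : nat -> V) (l : V) :
  series u @ \oo --> l <->
  series (fun k => u k.+1) @ \oo --> l - u 0%N.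
Proof.
rewrite -(cvg_shiftS (series u)).
have -> : [sequence series u n.+1]_n = (fun n => u 0%N + series (fun k => u k.+1) n).
  by apply/funext => n /=; rewrite seriesSl.
split=> h.
  have -> : series (fun k => u k.+1) =
     (fun n => (u 0%N + series (fun k => u k.+1) n) - u 0%N).
    by apply/funext => n; rewrite addrAC subrr add0r.
  by apply: cvgB => //; exact: cvg_cst.
rewrite -[l](subrK (u 0%N)) addrC.
by apply: cvgD => //; exact: cvg_cst.
Qed.

Lemma ccvg_seriesSl (R : realType) (u : nat -> R[i]) (l : R[i]) :
  ccvg (series u) l <-> ccvg (series (fun k => u k.+1)) (l - u 0%N).
Proof.
have reB (x y : R[i]) : complex.Re (x - y) = complex.Re x - complex.Re y.
  by case: x y => [? ?] [? ?].
have imB (x y : R[i]) : complex.Im (x - y) = complex.Im x - complex.Im y.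
  by case: x y => [? ?] [? ?].
split=> /ccvg_seriesP[ur ui]; apply/ccvg_seriesP.
  rewrite reB imB; split.
    exact: (cvg_seriesSl (fun k => complex.Re (u k)) _).1.
  exact: (cvg_seriesSl (fun k => complex.Im (u k)) _).1.
rewrite reB in ur; rewrite imB in ui; split.
  exact: (cvg_seriesSl (fun k => complex.Re (u k)) _).2.
exact: (cvg_seriesSl (fun k => complex.Im (u k)) _).2.
Qed.

(** * Uniqueness of Taylor coefficients *)

Lemma geometric_partial_le (R : realType) (t : R) n : 0 <= t -> t <= 1 / 2 ->
  \sum_(0 <= k < n) t ^+ k + 2 * t ^+ n <= 2.
Proof.
move=> t0 t1; elim: n => [|n IH]; first by rewrite big_geq// expr0; lra.
rewrite big_nat_recr//= exprS; apply: le_trans IH.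
by have := exprn_ge0 n t0; nra.
Qed.

(** Convergence at 1/2 bounds [c k] by [B * 2 ^+ k], so for small [x] the terms
    of positive degree add up to at most [4 * B * x]: the sum tends to [c 0] as
    [x] tends to 0. *)
Lemma pseries_zero_coef0 (R : realType) (c : nat -> R) :
  (forall x : R, 0 < x < 1 -> series (fun k => c k * x ^+ k) @ \oo --> (0 : R)) ->
  c 0%N = 0.
Proof.
move=> hc.
have h2 : 0 < (1 / 2 : R) < 1 by apply/andP; split; lra.
have /cvg_series_cvg_0 c0 := cvgP _ (hc _ h2).
have [B [B0 hB]] : exists B : R, 0 < B /\ forall k, `|c k| <= B * 2 ^+ k.
  have /cvg_seq_bounded [B [_ hB]] := cvgP _ c0.
  exists (`|B| + 1); split; first by rewrite ltr_wpDl.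
  move=> k; have := hB (`|B| + 1) (ltr_pwDr ltr01 (ler_norm _)) k I.
  rewrite /= normrM normrX div1r (@gtr0_norm _ 2^-1) ?invr_gt0// exprVn.
  by rewrite ler_pdivrMr// exprn_gt0.
have bnd x n : 0 < x -> x <= 1 / 4 ->
    `|series (fun k => c k * x ^+ k) n.+1 - c 0%N| <= 4 * B * x.
  move=> x0 x4; rewrite seriesSl expr0 mulr1 addrAC subrr add0r.
  have : \sum_(0 <= k < n) (2 * x) ^+ k <= 2.
    have t0 : 0 <= 2 * x by lra.
    have t1 : 2 * x <= 1 / 2 by lra.
    by have := geometric_partial_le n t0 t1; have := exprn_ge0 n t0; lra.
  move=> hs; apply: le_trans (ler_norm_sum _ _ _) _.
  apply: (@le_trans _ _ (\sum_(0 <= k < n) (2 * B * x) * (2 * x) ^+ k)).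
    apply: ler_sum => k _; rewrite normrM normrX (gtr0_norm x0) exprMn exprS.
    have := hB k.+1; rewrite exprS => h.
    have xk : 0 <= x ^+ k by rewrite exprn_ge0 ?ltW.
    have xx : 0 <= x * x ^+ k by rewrite mulr_ge0// ltW.
    apply: le_trans (ler_wpM2r xx h) _.
    by rewrite le_eqVlt; apply/orP; left; apply/eqP; ring.
  by rewrite -mulr_sumr; have := mulr_gt0 B0 x0; nra.
have lim x : 0 < x -> x <= 1 / 4 -> `|c 0%N| <= 4 * B * x.
  move=> x0 x4.
  have x01 : 0 < x < 1 by apply/andP; split=> //; lra.
  have : (fun n => `|series (fun k => c k * x ^+ k) n.+1 - c 0%N|) @ \oo
           --> `|0 - c 0%N|.
    apply: cvg_norm; apply: cvgB; last exact: cvg_cst.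
    by have := hc _ x01; rewrite -(cvg_shiftS (series _)).
  rewrite sub0r normrN => hl.
  rewrite -(cvg_lim (@Rhausdorff R) hl); apply: limr_le.
    by apply/cvg_ex; exists `|c 0%N|.
  by near=> n; exact: bnd.
apply/eqP; rewrite -normr_le0 leNgt; apply/negP => p.
pose x := Num.min (1 / 4) (`|c 0%N| / (8 * B)).
have q : 0 < `|c 0%N| / (8 * B) by rewrite divr_gt0// mulr_gt0.
have x0 : 0 < x by rewrite lt_min q andbT; lra.
have x4 : x <= 1 / 4 by rewrite ge_min lexx.
have := lim _ x0 x4.
have : x <= `|c 0%N| / (8 * B) by rewrite ge_min lexx orbT.
rewrite ler_pdivlMr ?mulr_gt0// => h1 h2'; lra.
Unshelve. all: by end_near.
Qed.

(** Dividing by [x] turns the series into the one with shifted coefficients,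
    which again vanishes on the open interval; hence the restriction of the
    hypothesis to [0 < x]. *)
Lemma pseries_zero_real (R : realType) (c : nat -> R) :
  (forall x : R, 0 < x < 1 -> series (fun k => c k * x ^+ k) @ \oo --> (0 : R)) ->
  forall k, c k = 0.
Proof.
move=> hc k; elim: k c hc => [|k IH] c hc; first exact: pseries_zero_coef0.
apply: (IH (fun k => c k.+1)) => x x01.
have /cvg_seriesSl := hc _ x01.
rewrite (pseries_zero_coef0 hc) mul0r subr0 => h.
have x0 : x != 0 by case/andP: x01 => /gt_eqF ->.
have -> : series (fun k => c k.+1 * x ^+ k) =
    (fun n => x^-1 * series (fun k => c k.+1 * x ^+ k.+1) n).
  apply/funext => n; rewrite /series /= mulr_sumr; apply: eq_bigr => j _.
  by rewrite exprS (mulrCA (c _)) mulKf.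
by rewrite -[X in _ --> X](mulr0 x^-1); apply: cvgM => //; exact: cvg_cst.
Qed.

(** * The scalar Hardy space *)

Definition l2 {R : realType} (a : nat -> R[i]) : Prop :=
  cvgn (series (fun k => sqmod (a k)) : nat -> R).

(** The point 0 is left out so that the statement also identifies the value at
    the removable singularity of a quotient by [z]. *)
Lemma is_taylor_unique_off0 (R : realType) (f g : disc R -> R[i]) a b :
  is_taylor f a -> is_taylor g b -> (forall z, val z != 0 -> f z = g z) -> a = b.
Proof.
move=> fa gb fg.
have key (x : R) : 0 < x < 1 ->
    ccvg (series (fun k => (a k - b k) * x%:C%C ^+ k)) 0.
  move=> /andP[x0 x1].
  have xd : `|x%:C%C| < 1 :> R[i].
    by rewrite (norm_lt_sqmod _ ltr01) sqmodE /=; nra.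
  pose z : disc R := exist _ x%:C%C xd.
  have z0 : val z != 0 by rewrite /= eq_complex /= gt_eqF.
  have := ccvg_comb (c := -1) (gb z) (fa z).
  rewrite (fg _ z0) mulN1r addNr; apply: ccvg_ext => n.
  rewrite mulN1r addrC /series /= -sumrB; apply: eq_bigr => k _.
  by rewrite mulrBl.
(* Real points [x] separate the real and imaginary parts of the coefficients. *)
have realX (w : R[i]) (x : R) k :
    complex.Re (w * x%:C%C ^+ k) = complex.Re w * x ^+ k /\
    complex.Im (w * x%:C%C ^+ k) = complex.Im w * x ^+ k.
  by rewrite -rmorphXn; case: w => p q /=; split; ring.
apply/funext => k; apply/eqP; rewrite -subr_eq0 eq_complex /=.
apply/andP; split; apply/eqP.
  apply: (@pseries_zero_real _ (fun k => complex.Re (a k - b k))) => x x01.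
  have /ccvg_seriesP[+ _] := key _ x01.
  apply: cvgn_ext => n; apply: eq_bigr => j _.
  by rewrite (realX _ _ _).1.
apply: (@pseries_zero_real _ (fun k => complex.Im (a k - b k))) => x x01.
have /ccvg_seriesP[_ +] := key _ x01.
apply: cvgn_ext => n; apply: eq_bigr => j _.
by rewrite (realX _ _ _).2.
Qed.

Lemma taylorE (R : realType) (f : disc R -> R[i]) a : is_taylor f a -> taylor f = a.
Proof.
move=> fa; apply: (@is_taylor_unique_off0 _ f f) => //.
by apply: xgetPex; exists a.
Qed.

Lemma hardy1P (R : realType) (f : disc R -> R[i]) :
  hardy1 f -> is_taylor f (taylor f) /\ l2 (taylor f).
Proof. by move=> [a [fa la]]; rewrite (taylorE fa). Qed.

Lemma hardy1_eq_off0 (R : realType) (f g : disc R -> R[i]) :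
  hardy1 f -> hardy1 g -> (forall z, val z != 0 -> f z = g z) -> f = g.
Proof.
move=> /hardy1P[fa _] /hardy1P[gb _] fg; apply/funext => z.
have := fa z; rewrite (is_taylor_unique_off0 fa gb fg) => h.
exact: ccvg_unique h (gb z).
Qed.

Lemma hardy1_taylor_inj (R : realType) (f g : disc R -> R[i]) :
  hardy1 f -> hardy1 g -> taylor f = taylor g -> f = g.
Proof.
move=> /hardy1P[fa _] /hardy1P[gb _] fg; apply/funext => z.
have := fa z; rewrite fg => h; exact: ccvg_unique h (gb z).
Qed.

Lemma is_taylor_comb (R : realType) (c : R[i]) (f g : disc R -> R[i]) a b :
  is_taylor f a -> is_taylor g b ->
  is_taylor (fun z => c * f z + g z) (fun k => c * a k + b k).
Proof.
move=> fa gb z.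
have := ccvg_comb (c := c) (fa z) (gb z); apply: ccvg_ext => n.
rewrite /series /= mulr_sumr -big_split; apply: eq_bigr => k _ /=.
by rewrite mulrDl mulrA.
Qed.

Lemma series_ge0_cvgP (R : realType) (u : nat -> R) (B : R) :
  (forall k, 0 <= u k) -> (forall n, series u n <= B) ->
  cvgn (series u) /\ limn (series u) <= B.
Proof.
move=> u0 uB; have cu : cvgn (series u).
  apply: nondecreasing_is_cvgn; first exact: nondecreasing_series.
  by exists B => _ [n _ <-].
by split=> //; apply: limr_le => //; near=> n.
Unshelve. all: by end_near.
Qed.

Lemma l2_comb (R : realType) (c : R[i]) (a b : nat -> R[i]) :
  l2 a -> l2 b -> l2 (fun k => c * a k + b k).
Proof.
move=> la lb.
apply: (@series_le_cvg _ _ (fun k => (2 * sqmod c) * sqmod (a k) + 2 * sqmod (b k))).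
- by move=> k; exact: sqmod_ge0.
- move=> k; apply: addr_ge0; apply: mulr_ge0; rewrite ?sqmod_ge0//.
  by apply: mulr_ge0; rewrite ?sqmod_ge0.
- by move=> k; apply: le_trans (sqmodD_le _ _) _; rewrite sqmodM mulrA.
have -> : series (fun k => (2 * sqmod c) * sqmod (a k) + 2 * sqmod (b k)) =
   (2 * sqmod c) *: series (fun k => sqmod (a k)) + 2 *: series (fun k => sqmod (b k)).
  apply/funext => n; rewrite fctE /series /= big_split /= -!mulr_sumr.
  by [].
by apply: is_cvgD; apply: is_cvgZl_tmp.
Qed.

Lemma hardy1_comb (R : realType) (c : R[i]) (f g : disc R -> R[i]) :
  hardy1 f -> hardy1 g -> hardy1 (fun z => c * f z + g z).
Proof.
move=> [a [fa la]] [b [gb lb]].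
exists (fun k => c * a k + b k); split; [exact: is_taylor_comb|exact: l2_comb].
Qed.

Lemma taylor_comb (R : realType) (c : R[i]) (f g : disc R -> R[i]) :
  hardy1 f -> hardy1 g ->
  taylor (fun z => c * f z + g z) = (fun k => c * taylor f k + taylor g k).
Proof.
by move=> /hardy1P[fa _] /hardy1P[gb _]; apply: taylorE; exact: is_taylor_comb.
Qed.

Lemma is_taylor0 (R : realType) : is_taylor (fun _ : disc R => 0 : R[i]) (fun=> 0).
Proof.
move=> z; have -> : series (fun k => 0 * val z ^+ k) = (fun=> 0 : R[i]).
  by apply/funext => n; rewrite /series /= big1// => k _; rewrite mul0r.
exact: ccvg_cst.
Qed.

Lemma hardy1_0 (R : realType) : hardy1 (fun _ : disc R => 0 : R[i]).
Proof.
exists (fun=> 0); split; first exact: is_taylor0.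
have -> : (fun k : nat => complex.Re `|(0 : R[i])| ^+ 2) = (fun=> 0 : R).
  by apply/funext => k; exact: sqmod0.
have -> : series (fun=> 0) = (fun=> 0 : R).
  by apply/funext => n; rewrite /series /= big1.
exact: is_cvg_cst.
Qed.

Lemma ccvg_pseries0 (R : realType) (a : nat -> R[i]) :
  ccvg (series (fun k => a k * 0 ^+ k)) (a 0%N).
Proof.
apply/ccvg_seriesSl; rewrite expr0 mulr1 subrr.
have -> : series (fun k => a k.+1 * 0 ^+ k.+1) = (fun=> 0 : R[i]).
  by apply/funext => n; rewrite /series /= big1// => k _; rewrite expr0n mulr0.
exact: ccvg_cst.
Qed.

Lemma is_taylor_disc0 (R : realType) (f : disc R -> R[i]) a :
  is_taylor f a -> f disc0 = a 0%N.
Proof. by move=> fa; apply: (ccvg_unique (fa disc0)); exact: ccvg_pseries0. Qed.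

Lemma hardy1_disc0 (R : realType) (f : disc R -> R[i]) :
  hardy1 f -> f disc0 = taylor f 0%N.
Proof. by move=> /hardy1P[/is_taylor_disc0]. Qed.

(** On the disc the terms are dominated by [sqmod (a k) + sqmod z ^+ k], the
    general term of a convergent series. *)
Lemma l2_hardy1 (R : realType) (a : nat -> R[i]) : l2 a ->
  exists2 f : disc R -> R[i], hardy1 f & taylor f = a.
Proof.
move=> la.
have h (z : disc R) : exists l, ccvg (series (fun k => a k * val z ^+ k)) l.
  pose v k := sqmod (a k) + sqmod (val z) ^+ k.
  have v0 k : 0 <= v k.
    by apply: addr_ge0; [exact: sqmod_ge0|exact/exprn_ge0/sqmod_ge0].
  apply: (@dominated_series_cvg _ _ v) => // [k|].
    rewrite sqmodM sqmodX /v.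
    exact: mul_le_sqrD (sqmod_ge0 _) (exprn_ge0 _ (sqmod_ge0 _)).
  have -> : series v = series (fun k => sqmod (a k)) +
      series (geometric 1 (sqmod (val z))).
    apply/funext => n; rewrite fctE /series /= big_split /=; congr (_ + _).
    by apply: eq_bigr => k _; rewrite /geometric /= mul1r.
  apply: is_cvgD => //; apply: is_cvg_geometric_series.
  by rewrite ger0_norm ?sqmod_ge0// sqmod_disc.
have [f hf] := choice h.
by exists f; [exists a|exact: taylorE].
Qed.

Lemma hardy1B (R : realType) (f g : disc R -> R[i]) :
  hardy1 f -> hardy1 g -> hardy1 (fun z => f z - g z).
Proof.
move=> hf hg; have := hardy1_comb (-1) hg hf.
by under eq_fun do rewrite mulN1r addrC.
Qed.

Lemma taylorB (R : realType) (f g : disc R -> R[i]) :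
  hardy1 f -> hardy1 g ->
  taylor (fun z => f z - g z) = (fun k => taylor f k - taylor g k).
Proof.
move=> hf hg; have := taylor_comb (-1) hg hf.
under eq_fun do rewrite mulN1r addrC.
by move=> ->; apply/funext => k; rewrite mulN1r addrC.
Qed.

Lemma hardy1_dot_cvg (R : realType) (f g : disc R -> R[i]) :
  hardy1 f -> hardy1 g ->
  ccvg (series (fun k => taylor f k * (taylor g k)^*)) (hardy1_dot f g).
Proof.
move=> /hardy1P[_ la] /hardy1P[_ lb].
suff [l hl] : exists l, ccvg (series (fun k => taylor f k * (taylor g k)^*)) l.
  by rewrite /hardy1_dot (ccvg_lim hl).
apply: (@dominated_series_cvg _ _ (fun k => sqmod (taylor f k) + sqmod (taylor g k))).
- by move=> k; apply: addr_ge0; exact: sqmod_ge0.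
- by move=> k; rewrite sqmodM sqmodJ mul_le_sqrD ?sqmod_ge0.
have -> : series (fun k => sqmod (taylor f k) + sqmod (taylor g k)) =
   series (fun k => sqmod (taylor f k)) + series (fun k => sqmod (taylor g k)).
  by apply/funext => n; rewrite fctE /series /= big_split.
exact: (is_cvgD la lb).
Qed.

Lemma hardy1_dot_comb (R : realType) (c : R[i]) (f g h : disc R -> R[i]) :
  hardy1 f -> hardy1 g -> hardy1 h ->
  hardy1_dot (fun z => c * f z + g z) h = c * hardy1_dot f h + hardy1_dot g h.
Proof.
move=> hf hg hh.
apply: (ccvg_unique (hardy1_dot_cvg (hardy1_comb c hf hg) hh)).
have := ccvg_comb (c := c) (hardy1_dot_cvg hf hh) (hardy1_dot_cvg hg hh).
apply: ccvg_ext => n; rewrite taylor_comb// /series /= mulr_sumr -big_split.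
by apply: eq_bigr => k _ /=; rewrite mulrDl mulrA.
Qed.

Lemma hardy1_dotJ (R : realType) (f g : disc R -> R[i]) :
  hardy1 f -> hardy1 g -> hardy1_dot g f = (hardy1_dot f g)^*.
Proof.
move=> hf hg; apply: (ccvg_unique (hardy1_dot_cvg hg hf)).
have := ccvgJ (hardy1_dot_cvg hf hg); apply: ccvg_ext => n.
rewrite /series /= rmorph_sum; apply: eq_bigr => k _ /=.
by rewrite rmorphM /= conjCK mulrC.
Qed.

Definition hardy1_sqnorm {R : realType} (f : disc R -> R[i]) : R :=
  limn (series (fun k => sqmod (taylor f k))).

Lemma hardy1_dot_sqnorm (R : realType) (f : disc R -> R[i]) :
  hardy1 f -> hardy1_dot f f = (hardy1_sqnorm f)%:C%C.
Proof.
move=> hf; apply: (ccvg_unique (hardy1_dot_cvg hf hf)).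
have [_ la] := hardy1P hf.
apply/ccvg_seriesP; split => /=.
  move: la; rewrite /l2; apply: cvgn_ext => n; apply: eq_bigr => k _.
  by rewrite mulJ_sqmod.
have -> : series (fun k => complex.Im (taylor f k * (taylor f k)^*)) = (fun=> 0).
  by apply/funext => n; rewrite /series /= big1// => k _; rewrite mulJ_sqmod.
exact: cvg_cst.
Qed.

Lemma sqmod_taylor_le (R : realType) (f : disc R -> R[i]) k :
  hardy1 f -> sqmod (taylor f k) <= hardy1_sqnorm f.
Proof.
move=> /hardy1P[_ la].
have nd : nondecreasing_seq (series (fun k => sqmod (taylor f k))).
  by apply: nondecreasing_series => *; exact: sqmod_ge0.
apply: le_trans (nondecreasing_cvgn_le nd la k.+1).
rewrite /series /= big_nat_recr//= lerDr sumr_ge0// => j _; exact: sqmod_ge0.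
Qed.

(** The Cauchy property is expressed by a rate [e p + e q]: it passes to sums
    and to limits in [q] without any bookkeeping of thresholds. *)
Lemma cvg_of_sq_rate (R : realType) (u e : nat -> R) :
  e @ \oo --> (0 : R) -> (forall p q, (u p - u q) ^+ 2 <= e p + e q) -> cvgn u.
Proof.
move=> e0 ue; apply/cauchy_cvgP; apply: cauchy_exP => d d0.
have d2 : 0 < d ^+ 2 / 2 by rewrite divr_gt0// exprn_gt0.
have /cvgrPdist_lt/(_ _ d2)[N _ hN] := e0.
exists (u N); exists N => // p /= Np; rewrite /ball /=.
have := hN _ (leqnn N); have := hN _ Np; rewrite /= !sub0r !normrN => h1 h2.
have := ler_norm (e p); have := ler_norm (e N); have := ue N p => h3 h4 h5.
rewrite -(ltr_pXn2r (n := 2))// ?nnegrE ?ltW// real_normK ?num_real//.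
lra.
Qed.

Lemma cvg_sqmodB (R : realType) (u : nat -> R[i]) (c l : R[i]) :
  ccvg u l -> (fun n => sqmod (c - u n)) @ \oo --> sqmod (c - l).
Proof.
move=> /ccvgP[ur ui].
have h (v : nat -> R) (m d : R) :
    v @ \oo --> m -> (fun n => (d - v n) ^+ 2) @ \oo --> (d - m) ^+ 2.
  by move=> vm; apply: cvgM; apply: cvgB => //; exact: cvg_cst.
rewrite sqmodE; case: c l ur ui => [a b] [x y] /= ur ui.
apply: (cvgn_ext _ (cvgD (h _ _ a ur) (h _ _ b ui))) => n.
by rewrite fctE sqmodE; case: (u n).
Qed.

(** Completeness of [l2]: the coefficients converge one by one, and letting [q]
    tend to infinity in the finite partial sums of the norm of [G p - G q]
    bounds the partial sums for the limit by [e p]. *)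
Lemma hardy1_complete (R : realType) (G : nat -> disc R -> R[i]) (e : nat -> R) :
  (forall p, hardy1 (G p)) -> e @ \oo --> (0 : R) ->
  (forall p q, hardy1_sqnorm (fun z => G p z - G q z) <= e p + e q) ->
  exists2 f, hardy1 f & forall p, hardy1_sqnorm (fun z => f z - G p z) <= e p.
Proof.
move=> hG e0 eG; pose a p := taylor (G p).
have la p : l2 (a p) by have [] := hardy1P (hG p).
have coef k : exists l, ccvg (fun p => a p k) l.
  have aB p q : sqmod (a p k - a q k) <= e p + e q.
    have := sqmod_taylor_le k (hardy1B (hG p) (hG q)).
    by rewrite taylorB// => /le_trans; apply.
  have [cr ci] : cvgn (fun p => complex.Re (a p k)) /\
      cvgn (fun p => complex.Im (a p k)).
    split; apply: cvg_of_sq_rate e0 _ => p q; apply: le_trans (aB p q);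
      rewrite sqmodE; case: (a p k) (a q k) => [x y] [x' y'] /=.
      by rewrite lerDl sqr_ge0.
    by rewrite lerDr sqr_ge0.
  exists (limn (fun p => complex.Re (a p k)) +i*
          limn (fun p => complex.Im (a p k)))%C.
  by apply/ccvgP.
have [l hl] := choice coef.
have part p n : series (fun k => sqmod (a p k - l k)) n <= e p.
  have lim1 : (fun q => series (fun k => sqmod (a p k - a q k)) n) @ \oo -->
      series (fun k => sqmod (a p k - l k)) n.
    rewrite /series /=; elim: n => [|n IH].
      by rewrite big_geq//; apply: cvgn_ext (cvg_cst _) => q; rewrite big_geq.
    rewrite big_nat_recr//=.
    apply: (cvgn_ext _ (cvgD IH (cvg_sqmodB (c := a p n) (hl n)))) => q.
    by rewrite big_nat_recr.
  have lim2 : (fun q => e p + e q) @ \oo --> e p + 0.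
    by apply: cvgD => //; exact: cvg_cst.
  rewrite -[e p]addr0.
  apply: (ler_cvg_to lim1 lim2); near=> q.
  have hB := hardy1B (hG p) (hG q); have [_ lB] := hardy1P hB.
  apply: le_trans (eG p q); rewrite /hardy1_sqnorm.
  have nd : nondecreasing_seq (series (fun k => sqmod (a p k - a q k))).
    by apply: nondecreasing_series => *; exact: sqmod_ge0.
  rewrite (taylorB (hG p) (hG q)) in lB; rewrite (taylorB (hG p) (hG q)).
  exact: nondecreasing_cvgn_le nd lB n.
have dl p : l2 (fun k => a p k - l k) /\
    limn (series (fun k => sqmod (a p k - l k))) <= e p.
  by apply: series_ge0_cvgP => // k; exact: sqmod_ge0.
have ll : l2 l.
  have := l2_comb (c := -1) (dl 0%N).1 (la 0%N).
  by under eq_fun do rewrite mulN1r opprB subrK.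
have [f hf fl] := l2_hardy1 ll.
exists f; first exact: hf.
move=> p; rewrite /hardy1_sqnorm (taylorB hf (hG p)) fl.
have := (dl p).2.
rewrite (_ : (fun k => sqmod (a p k - l k)) = fun k => sqmod (l k - a p k))//.
by apply/funext => k; rewrite -sqmodN opprB.
Unshelve. all: by end_near.
Qed.

Definition bshift1 {R : realType} (f : disc R -> R[i]) : disc R -> R[i] := fun z =>
  if val z == 0 then taylor f 1%N else (val z)^-1 * (f z - f disc0).

Lemma is_taylor_bshift1 (R : realType) (f : disc R -> R[i]) :
  hardy1 f -> is_taylor (bshift1 f) (fun k => taylor f k.+1).
Proof.
move=> hf z; rewrite -/(ccvg _ _) /bshift1; have [fa _] := hardy1P hf.
case: eqP => [z0|/eqP z0].
  apply: (ccvg_ext _ (ccvg_pseries0 (a := fun k => taylor f k.+1))) => n.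
  by apply: eq_bigr => k _; rewrite z0.
have /ccvg_seriesSl := fa z; rewrite expr0 mulr1 -(hardy1_disc0 hf) => h.
have := ccvg_comb (c := (val z)^-1) h (@ccvg_cst R 0); rewrite addr0.
apply: ccvg_ext => n; rewrite addr0 /series /= mulr_sumr; apply: eq_bigr => k _.
by rewrite exprS (mulrCA (taylor _ _)) mulKf.
Qed.

Lemma hardy1_bshift1 (R : realType) (f : disc R -> R[i]) :
  hardy1 f -> hardy1 (bshift1 f).
Proof.
move=> hf; exists (fun k => taylor f k.+1); split; first exact: is_taylor_bshift1.
have [_ la] := hardy1P hf.
exact: cvgP _ ((cvg_seriesSl (fun k => sqmod (taylor f k)) _).1 la).
Qed.

(** * The vector valued Hardy space *)

Lemma entry_comb (R : realType) n (c : R[i]) (F G : disc R -> 'cV[R[i]]_n) j :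
  entry (c *: F + G) j = (fun z => c * entry F j z + entry G j z).
Proof. by apply/funext => z; rewrite /entry mxE /= mxE. Qed.

Lemma entryB (R : realType) n (F G : disc R -> 'cV[R[i]]_n) j :
  entry (F - G) j = (fun z => entry F j z - entry G j z).
Proof. by apply/funext => z; rewrite /entry mxE /= mxE. Qed.

Lemma hardy_comb (R : realType) n (c : R[i]) (F G : disc R -> 'cV[R[i]]_n) :
  hardy n F -> hardy n G -> hardy n (c *: F + G).
Proof. by move=> hF hG j; rewrite entry_comb; apply: hardy1_comb. Qed.

Lemma hardyB (R : realType) n (F G : disc R -> 'cV[R[i]]_n) :
  hardy n F -> hardy n G -> hardy n (F - G).
Proof. by move=> hF hG j; rewrite entryB; apply: hardy1B. Qed.

Lemma hardy_0 (R : realType) n : hardy n (0 : disc R -> 'cV[R[i]]_n).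
Proof.
move=> j; rewrite (_ : entry 0 j = fun=> 0); first exact: hardy1_0.
by apply/funext => z; rewrite /entry mxE.
Qed.

Lemma hardy_eq_off0 (R : realType) n (F G : disc R -> 'cV[R[i]]_n) :
  hardy n F -> hardy n G -> (forall z, val z != 0 -> F z = G z) -> F = G.
Proof.
move=> hF hG FG; apply/funext => z; apply/colP => j.
have /(congr1 (fun f => f z)) : entry F j = entry G j.
  by apply: (hardy1_eq_off0 (hF j) (hG j)) => w w0; rewrite /entry FG.
by rewrite /entry.
Qed.

Lemma hardy_dot_comb (R : realType) n (c : R[i]) (F G H : disc R -> 'cV[R[i]]_n) :
  hardy n F -> hardy n G -> hardy n H ->
  hardy_dot (c *: F + G) H = c * hardy_dot F H + hardy_dot G H.
Proof.
move=> hF hG hH; rewrite /hardy_dot mulr_sumr -big_split; apply: eq_bigr => j _ /=.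
by rewrite entry_comb (hardy1_dot_comb _ (hF j) (hG j) (hH j)).
Qed.

Lemma hardy_dotJ (R : realType) n (F G : disc R -> 'cV[R[i]]_n) :
  hardy n F -> hardy n G -> hardy_dot G F = (hardy_dot F G)^*.
Proof.
move=> hF hG; rewrite /hardy_dot rmorph_sum; apply: eq_bigr => j _ /=.
by rewrite (hardy1_dotJ (hF j) (hG j)).
Qed.

Definition sqnorm {R : realType} {n} (F : disc R -> 'cV[R[i]]_n) : R :=
  \sum_(j < n) hardy1_sqnorm (entry F j).

Lemma hardy_dot_sqnorm (R : realType) n (F : disc R -> 'cV[R[i]]_n) :
  hardy n F -> hardy_dot F F = (sqnorm F)%:C%C.
Proof.
move=> hF; rewrite /hardy_dot /sqnorm rmorph_sum; apply: eq_bigr => j _ /=.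
by rewrite (hardy1_dot_sqnorm (hF j)).
Qed.

Lemma hardy_normE (R : realType) n (F : disc R -> 'cV[R[i]]_n) :
  hardy n F -> hardy_norm F = Num.sqrt (sqnorm F).
Proof. by move=> hF; rewrite /hardy_norm hardy_dot_sqnorm. Qed.

Lemma hardy1_sqnorm_ge0 (R : realType) (f : disc R -> R[i]) :
  hardy1 f -> 0 <= hardy1_sqnorm f.
Proof. by move=> hf; exact: le_trans (sqmod_ge0 _) (sqmod_taylor_le 0 hf). Qed.

Lemma entry_sqnorm_le (R : realType) n (F : disc R -> 'cV[R[i]]_n) j :
  hardy n F -> hardy1_sqnorm (entry F j) <= sqnorm F.
Proof.
move=> hF; rewrite /sqnorm (bigD1 j)//= lerDl sumr_ge0// => k _.
exact: hardy1_sqnorm_ge0 (hF k).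
Qed.

Lemma sqnorm_ge0 (R : realType) n (F : disc R -> 'cV[R[i]]_n) :
  hardy n F -> 0 <= sqnorm F.
Proof. by move=> hF; apply: sumr_ge0 => j _; exact: hardy1_sqnorm_ge0 (hF j). Qed.

Lemma sqnorm_eq0 (R : realType) n (F : disc R -> 'cV[R[i]]_n) :
  hardy n F -> sqnorm F = 0 -> F = 0.
Proof.
move=> hF F0; apply/funext => z; apply/colP => j.
rewrite -[LHS]/(entry F j z).
have -> : entry F j = (fun=> 0); last by rewrite mxE.
apply: hardy1_taylor_inj; [exact: hF|exact: hardy1_0|].
rewrite (taylorE (@is_taylor0 R)); apply/funext => k; apply: sqmod_eq0.
apply/eqP; rewrite eq_le sqmod_ge0 andbT -F0.
exact: le_trans (sqmod_taylor_le k (hF j)) (entry_sqnorm_le j hF).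
Qed.

Lemma sqmod_disc0_le (R : realType) n (F : disc R -> 'cV[R[i]]_n) j :
  hardy n F -> sqmod (F disc0 j 0) <= sqnorm F.
Proof.
move=> hF; have -> : F disc0 j 0 = entry F j disc0 by [].
rewrite (hardy1_disc0 (hF j)).
exact: le_trans (sqmod_taylor_le 0 (hF j)) (entry_sqnorm_le j hF).
Qed.

Lemma sqnorm_comb (R : realType) n (c : R[i]) (F G : disc R -> 'cV[R[i]]_n) :
  hardy n F -> hardy n G ->
  sqnorm (c *: F + G) =
    sqmod c * sqnorm F + 2 * complex.Re (c * hardy_dot F G) + sqnorm G.
Proof.
move=> hF hG; have hS := hardy_comb c hF hG.
have /(congr1 (@complex.Re R)) := hardy_dot_sqnorm hS.
rewrite [RHS]/= => <-.
rewrite hardy_dot_comb// (hardy_dotJ hS hF) (hardy_dotJ hS hG).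
rewrite !hardy_dot_comb// !hardy_dot_sqnorm// (hardy_dotJ hF hG) sqmodE.
case: c (hardy_dot F G) {hS} => [x y] [u v] /=.
by move: (sqnorm F) (sqnorm G) => a b; ring.
Qed.

(** The minimum of the quadratic polynomial is reached at [t = 1 / k]; when
    [k = 0] the polynomial is affine and a large [t] forces [s = 0]. *)
Lemma sqr_min_bound (R : realType) (s k x : R) : 0 <= s -> 0 <= k -> 0 <= x ->
  (forall t : R, 0 <= t ^+ 2 * s * k - 2 * t * s + x) -> s <= x * k.
Proof.
move=> s0 k0 x0 h; case: (ltrgtP k 0) => [|kp|ke]; first lra.
  have := h k^-1; have -> : k^-1 ^+ 2 * s * k = k^-1 * s.
    by rewrite expr2; field; rewrite gt_eqF.
  have -> : k^-1 * s - 2 * k^-1 * s + x = x - s / k by rewrite mulrC; ring.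
  by rewrite subr_ge0 ler_pdivrMr.
case: (ltrgtP s 0) => [|sp|se]; [lra| |by rewrite se ke mulr0].
(* This value of [t] makes the affine function equal to [- x - 2 < 0]. *)
have := h ((x + 1) / s).
have -> : 2 * ((x + 1) / s) * s = 2 * (x + 1) by rewrite mulrA mulfVK// gt_eqF.
by rewrite ke mulr0; lra.
Qed.

(** If moving [X] along [K] cannot bring the squared norm below [d], then [X] is
    orthogonal to [K] up to the excess [sqnorm X - d].  With [d = 0] this is the
    Cauchy-Schwarz inequality, and for a minimizing sequence it gives
    orthogonality of the limit. *)
Lemma sqmod_dot_le (R : realType) n (K X : disc R -> 'cV[R[i]]_n) (d : R) :
  hardy n K -> hardy n X -> d <= sqnorm X ->
  (forall c : R[i], d <= sqnorm (c *: K + X)) ->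
  sqmod (hardy_dot K X) <= (sqnorm X - d) * sqnorm K.
Proof.
move=> hK hX dX hd; apply: sqr_min_bound; rewrite ?sqmod_ge0 ?sqnorm_ge0 ?subr_ge0//.
(* Among multiples of [K], the direction of steepest decrease of the norm. *)
move=> t; have := hd (- (t%:C%C * (hardy_dot K X)^*)).
rewrite sqnorm_comb// sqmodN sqmodM sqmodJ.
have -> : sqmod t%:C%C = t ^+ 2 by rewrite sqmodE /= expr0n addr0.
have -> : complex.Re (- (t%:C%C * (hardy_dot K X)^*) * hardy_dot K X) =
    - (t * sqmod (hardy_dot K X)).
  by rewrite sqmodE; case: (hardy_dot K X) => u v /=; ring.
by move: (sqmod (hardy_dot K X)) (sqnorm K) (sqnorm X) => s k x h; lra.
Qed.

Lemma cauchy_schwarz (R : realType) n (F G : disc R -> 'cV[R[i]]_n) :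
  hardy n F -> hardy n G -> sqmod (hardy_dot F G) <= sqnorm G * sqnorm F.
Proof.
move=> hF hG; rewrite -[X in X * _](subr0).
apply: sqmod_dot_le => // [|c]; first exact: sqnorm_ge0.
exact/sqnorm_ge0/hardy_comb.
Qed.

Lemma hardy_complete (R : realType) n (G : nat -> disc R -> 'cV[R[i]]_n)
    (e : nat -> R) :
  (forall p, hardy n (G p)) -> e @ \oo --> (0 : R) ->
  (forall p q, sqnorm (G p - G q) <= e p + e q) ->
  exists2 F, hardy n F & forall p, sqnorm (F - G p) <= n%:R * e p.
Proof.
move=> hG e0 eG.
have /choice[f hf] : forall j, exists f, hardy1 f /\
    forall p, hardy1_sqnorm (fun z => f z - entry (G p) j z) <= e p.
  move=> j; have [||f ? ?] := @hardy1_complete _ (fun p => entry (G p) j) e _ e0.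
  - by move=> p; exact: hG.
  - move=> p q; rewrite -entryB; apply: le_trans (eG p q).
    exact: entry_sqnorm_le (hardyB (hG p) (hG q)).
  by exists f.
pose F : disc R -> 'cV[R[i]]_n := fun z => \col_j f j z.
have eF j : entry F j = f j.
  by apply/funext => z; rewrite /entry /F !mxE.
exists F; first by move=> j; rewrite eF; exact: (hf j).1.
move=> p; rewrite /sqnorm.
apply: (@le_trans _ _ (\sum_(j < n) e p)); last first.
  by rewrite sumr_const card_ord mulr_natl.
by apply: ler_sum => j _; rewrite entryB eF; exact: (hf j).2.
Qed.

Lemma entry_bshift (R : realType) n (F : disc R -> 'cV[R[i]]_n) j :
  entry (bshift F) j = bshift1 (entry F j).
Proof.
by apply/funext => z; rewrite /entry /bshift /bshift1; case: ifP; rewrite !mxE.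
Qed.

Lemma hardy_bshift (R : realType) n (F : disc R -> 'cV[R[i]]_n) :
  hardy n F -> hardy n (bshift F).
Proof. by move=> hF j; rewrite entry_bshift; exact: hardy1_bshift1 (hF j). Qed.

Lemma bshift_off0 (R : realType) n (F : disc R -> 'cV[R[i]]_n) z :
  F disc0 = 0 -> val z != 0 -> bshift F z = (val z)^-1 *: F z.
Proof. by move=> F0 z0; rewrite /bshift (negbTE z0) F0 subr0. Qed.

Lemma bshiftD (R : realType) n (F G : disc R -> 'cV[R[i]]_n) :
  hardy n F -> hardy n G -> bshift (F + G) = bshift F + bshift G.
Proof.
move=> hF hG.
have hD (A B : disc R -> 'cV[R[i]]_n) : hardy n A -> hardy n B -> hardy n (A + B).
  by move=> hA hB; rewrite -[A]scale1r; exact: hardy_comb.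
apply: hardy_eq_off0.
- exact/hardy_bshift/hD.
- by apply: hD; exact: hardy_bshift.
have addE (A B : disc R -> 'cV[R[i]]_n) w : (A + B) w = A w + B w by [].
move=> z z0; rewrite addE /bshift (negbTE z0) -scalerDr; congr (_ *: _).
by rewrite !addE opprD addrACA.
Qed.

(** A function of H^2 vanishing at 0 is [z] times its backward shift. *)
Lemma zhardyP (R : realType) n (F : disc R -> 'cV[R[i]]_n) :
  hardy n F -> zhardy n F <-> F disc0 = 0.
Proof.
move=> hF; split=> [[G _ <-]|F0]; first by rewrite /mulz /= scale0r.
exists (bshift F); first exact: hardy_bshift.
apply/funext => z; rewrite /mulz; have [z0|z0] := eqVneq (val z) 0.
  rewrite z0 scale0r -F0; congr F; apply: val_inj; by rewrite /= z0.
by rewrite bshift_off0// scalerA divff// scale1r.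
Qed.

(** * Finite-dimensional subspaces *)

Lemma row_dependent (K : fieldType) r k (A : 'M[K]_(r, k)) : (k < r)%N ->
  exists2 d : 'rV_r, d != 0 & d *m A = 0.
Proof.
move=> kr; have : kermx A != 0.
  rewrite kermx_eq0 /row_free; apply: contraTneq kr => <-.
  by rewrite -leqNgt rank_leq_col.
by case/rowV0Pn => d /sub_kermxP dA d0; exists d.
Qed.

(** The rows of [A] are coordinates of the [u j] that detect vanishing of linear
    combinations.  Attaching them to the family rather than to a linear map
    allows coordinates that are chosen and not unique. *)
Lemma lin_indep_le_coord (R : realType) n r k (u : 'I_r -> disc R -> 'cV[R[i]]_n)
    (A : 'M[R[i]]_(r, k)) :
  lin_indep u ->
  (forall d : 'rV_r, d *m A = 0 -> \sum_(j < r) d 0 j *: u j = 0) -> (r <= k)%N.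
Proof.
move=> iu hA; rewrite leqNgt; apply/negP => kr.
have [d d0 dA] := row_dependent A kr.
move: d0; rewrite (_ : d = 0) ?eqxx//.
by apply/rowP => j; rewrite mxE (iu (fun j => d 0 j) (hA _ dA)).
Qed.

Lemma comb_span_eq0 (K : fieldType) (V : lmodType K) r k (u : 'I_r -> V)
    (v : 'I_k -> V) (A : 'M[K]_(r, k)) (d : 'rV_r) :
  (forall j, u j = \sum_l A j l *: v l) -> d *m A = 0 ->
  \sum_(j < r) d 0 j *: u j = 0.
Proof.
move=> hu dA; under eq_bigr do rewrite hu scaler_sumr.
rewrite exchange_big big1// => l _ /=.
under eq_bigr do rewrite scalerA.
rewrite -scaler_suml; have /rowP/(_ l) := dA; rewrite !mxE => ->.
by rewrite scale0r.
Qed.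

Lemma subspace_sum (R : realType) n (X : set (disc R -> 'cV[R[i]]_n)) r
    (c : 'I_r -> R[i]) (v : 'I_r -> disc R -> 'cV[R[i]]_n) :
  is_subspace X -> (forall k, X (v k)) -> X (\sum_(k < r) c k *: v k).
Proof.
move=> [_ X0 XD] Xv; apply: (big_ind X) => //.
  by move=> F G XF XG; rewrite -[F]scale1r; exact: XD.
by move=> k _; rewrite -[_ *: _]addr0; exact: XD.
Qed.

Lemma subspaceB (R : realType) n (X : set (disc R -> 'cV[R[i]]_n)) F G :
  is_subspace X -> X F -> X G -> X (F - G).
Proof.
by move=> [_ _ XD] XF XG; rewrite addrC -scaleN1r; exact: XD.
Qed.

Definition dim_le {R : realType} {n} (X : set (disc R -> 'cV[R[i]]_n)) (k : nat) :=
  forall r (u : 'I_r -> disc R -> 'cV[R[i]]_n),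
    (forall j, X (u j)) -> lin_indep u -> (r <= k)%N.

Lemma max_family (T : Type) (P : forall r, ('I_r -> T) -> Prop) (k : nat)
    (u0 : 'I_0 -> T) :
  P 0%N u0 -> (forall r u, P r u -> (r <= k)%N) ->
  exists r (u : 'I_r -> T), P r u /\ forall v, ~ P r.+1 v.
Proof.
move=> P0 Pk; pose p r := `[< exists u, P r u >].
have ex : exists r, p r by exists 0%N; apply/asboolP; exists u0.
have ub r : p r -> (r <= k)%N by move=> /asboolP[u]; exact: Pk.
have [r /asboolP[u Pu] mx] := ex_maxnP ex ub.
exists r, u; split=> // v Pv.
have pr : p r.+1 by apply/asboolP; exists v.
by have := mx _ pr; rewrite ltnn.
Qed.

Definition extend {T : Type} r (x : T) (u : 'I_r -> T) : 'I_r.+1 -> T :=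
  fun j => if unlift ord0 j is Some k then u k else x.

Lemma extend0 (T : Type) r (x : T) (u : 'I_r -> T) : extend x u ord0 = x.
Proof. by rewrite /extend unlift_none. Qed.

Lemma extendS (T : Type) r (x : T) (u : 'I_r -> T) k :
  extend x u (lift ord0 k) = u k.
Proof. by rewrite /extend liftK. Qed.

Lemma extend_all (T : Type) (X : T -> Prop) r (x : T) (u : 'I_r -> T) :
  X x -> (forall k, X (u k)) -> forall j, X (extend x u j).
Proof.
by move=> Xx Xu j; case: (unliftP ord0 j) => [k ->|->]; rewrite ?extend0 ?extendS.
Qed.

(** An independent family of maximal size spans: otherwise a function outside
    of its span extends it. *)
Lemma dim_le_has_dim (R : realType) n (X : set (disc R -> 'cV[R[i]]_n)) k :
  is_subspace X -> dim_le X k -> exists m, has_dim X m.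
Proof.
move=> sX bX.
have [||r [u [[Xu iu] mx]]] := @max_family _
  (fun r (u : 'I_r -> _) => (forall j, X (u j)) /\ lin_indep u) k (fun=> 0).
- by split=> [[]|c _ []].
- by move=> r u [Xu iu]; exact: bX Xu iu.
exists r, u; split=> //; apply/seteqP; split=> [F XF|F [c ->]]; last exact: subspace_sum.
apply: contrapT => nF; apply: (mx (extend F u)); split; first exact: extend_all.
move=> c; rewrite big_ord_recl extend0.
under eq_bigr do rewrite extendS.
move=> h; have c0 : c ord0 = 0.
  apply: contrapT => /eqP c0; apply: nF.
  exists (fun k => - (c ord0)^-1 * c (lift ord0 k)).
  under eq_bigr do rewrite -scalerA.
  rewrite -scaler_sumr scaleNr; apply: (scalerI c0).
  by rewrite scalerN scalerA divff// scale1r; apply/eqP; rewrite -addr_eq0 h.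
move: h; rewrite c0 scale0r add0r => /(iu (fun k => c (lift ord0 k))) h j.
by case: (unliftP ord0 j) => [k' ->|->].
Qed.

Lemma hardy_dot0l (R : realType) n (G : disc R -> 'cV[R[i]]_n) :
  hardy n G -> hardy_dot 0 G = 0.
Proof.
move=> hG; have h0 := @hardy_0 R n.
have := hardy_dot_comb (-1) h0 h0 hG.
by rewrite scaler0 addr0 mulN1r addNr.
Qed.

Lemma hardy_dotZl (R : realType) n c (F G : disc R -> 'cV[R[i]]_n) :
  hardy n F -> hardy n G -> hardy_dot (c *: F) G = c * hardy_dot F G.
Proof.
move=> hF hG; rewrite -[c *: F]addr0 (hardy_dot_comb c hF (@hardy_0 R n) hG).
by rewrite hardy_dot0l// addr0.
Qed.

Lemma hardy_dotBl (R : realType) n (F G H : disc R -> 'cV[R[i]]_n) :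
  hardy n F -> hardy n G -> hardy n H ->
  hardy_dot (F - G) H = hardy_dot F H - hardy_dot G H.
Proof.
move=> hF hG hH; rewrite addrC -scaleN1r (hardy_dot_comb _ hG hF hH).
by rewrite mulN1r addrC.
Qed.

Lemma hardy_dot_suml (R : realType) n r (c : 'I_r -> R[i])
    (v : 'I_r -> disc R -> 'cV[R[i]]_n) G :
  (forall k, hardy n (v k)) -> hardy n G ->
  hardy_dot (\sum_(k < r) c k *: v k) G = \sum_(k < r) c k * hardy_dot (v k) G.
Proof.
move=> hv hG.
suff [] : hardy n (\sum_(k < r) c k *: v k) /\
  hardy_dot (\sum_(k < r) c k *: v k) G = \sum_(k < r) c k * hardy_dot (v k) G by [].
apply: (big_rec2 (fun x y => hardy n x /\ hardy_dot x G = y)).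
  by split; [exact: hardy_0|exact: hardy_dot0l].
move=> k y x _ [hx <-]; split; first exact: hardy_comb (hv k) hx.
exact: hardy_dot_comb (hv k) hx hG.
Qed.

Definition orthonormal {R : realType} {n} r (v : 'I_r -> disc R -> 'cV[R[i]]_n) :=
  forall j k, hardy_dot (v j) (v k) = (j == k)%:R.

Lemma orthonormal_dot_sum (R : realType) n r (c : 'I_r -> R[i])
    (v : 'I_r -> disc R -> 'cV[R[i]]_n) j :
  (forall k, hardy n (v k)) -> orthonormal v ->
  hardy_dot (\sum_(k < r) c k *: v k) (v j) = c j.
Proof.
move=> hv ov; rewrite hardy_dot_suml// (bigD1 j)//= ov eqxx mulr1 big1 ?addr0//.
by move=> k kj; rewrite ov (negbTE kj) mulr0.
Qed.

Lemma orthonormal_indep (R : realType) n r (v : 'I_r -> disc R -> 'cV[R[i]]_n) :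
  (forall k, hardy n (v k)) -> orthonormal v -> lin_indep v.
Proof.
by move=> hv ov c c0 j; rewrite -(orthonormal_dot_sum c j hv ov) c0 hardy_dot0l.
Qed.

(** In a maximal orthonormal family of [X], the Gram-Schmidt remainder [G] of
    any [F] is zero, since otherwise it could be normalized and adjoined. *)
Lemma orthonormal_basis_exists (R : realType) n (X : set (disc R -> 'cV[R[i]]_n)) k :
  is_subspace X -> dim_le X k ->
  exists r (v : 'I_r -> disc R -> 'cV[R[i]]_n), orthonormal_basis X v.
Proof.
move=> sX bX; have [hX _ XD] := sX.
have [||r [v [[Xv ov] mx]]] := @max_family _
  (fun r (u : 'I_r -> _) => (forall j, X (u j)) /\ orthonormal u) k (fun=> 0).
- by split=> [[]|[]].
- move=> r u [Xu ou]; apply: (bX r u Xu); apply: orthonormal_indep ou => j.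
  exact: hX.
have hv j : hardy n (v j) by exact: hX.
exists r, v; split=> //; apply/seteqP; split=> [F XF|F [c ->]]; last exact: subspace_sum.
pose S := \sum_(k < r) hardy_dot F (v k) *: v k.
have XS : X S by exact: subspace_sum.
pose G := F - S; have XG : X G by exact: subspaceB.
have [hF hS hG] : [/\ hardy n F, hardy n S & hardy n G] by split; exact: hX.
have Gv j : hardy_dot G (v j) = 0.
  by rewrite (hardy_dotBl hF hS (hv j)) (orthonormal_dot_sum _ _ hv ov) subrr.
apply: contrapT => nF; have N0 : 0 < sqnorm G.
  rewrite lt_neqAle (sqnorm_ge0 hG) andbT; apply/eqP => N0; apply: nF.
  exists (fun k => hardy_dot F (v k)); apply/eqP; rewrite -subr_eq0 -/S -/G.
  by rewrite (sqnorm_eq0 hG).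
pose a : R[i] := ((Num.sqrt (sqnorm G))^-1)%:C%C.
have XaG : X (a *: G) by rewrite -[_ *: _]addr0; apply: XD => //; have [] := sX.
have haG := hX _ XaG.
have aGv j : hardy_dot (a *: G) (v j) = 0 by rewrite (hardy_dotZl _ hG (hv j)) Gv mulr0.
apply: (mx (extend (a *: G) v)); split; first exact: extend_all.
move=> i j; case: (unliftP ord0 i) => [i' ->|->];
  case: (unliftP ord0 j) => [j' ->|->]; rewrite ?extend0 ?extendS.
- by rewrite ov (inj_eq lift_inj).
- by rewrite (hardy_dotJ haG (hv i')) aGv conjC0.
- by rewrite aGv.
rewrite eqxx (hardy_dotZl _ hG haG) (hardy_dotJ haG hG) (hardy_dotZl _ hG hG).
rewrite (hardy_dot_sqnorm hG).
rewrite /a; set N := sqnorm G in N0 *.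
have Ns : Num.sqrt N != 0 by rewrite sqrtr_eq0 -ltNge.
apply/eqP; rewrite eq_complex /= !mul0r !mulr0 !subr0 !addr0 oppr0 !mulr0 eqxx andbT.
rewrite -[X in _ * (_ * X)](sqr_sqrtr (ltW N0)); apply/eqP.
by field; exact: Ns.
Qed.

(** * Orthogonal decomposition along evaluation at 0 *)

Lemma sqnorm_parallelogram (R : realType) n (X Y : disc R -> 'cV[R[i]]_n) :
  hardy n X -> hardy n Y ->
  sqnorm (X - Y) + 4 * sqnorm (2^-1 *: (1 *: Y + X)) = 2 * sqnorm X + 2 * sqnorm Y.
Proof.
move=> hX hY; have hZ := hardy_comb 1 hY hX.
have h0 : sqnorm (0 : disc R -> 'cV[R[i]]_n) = 0.
  have := hardy_dot_sqnorm (@hardy_0 R n).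
  by rewrite (hardy_dot0l (@hardy_0 R n)) => -[].
rewrite -[2^-1 *: _]addr0 (sqnorm_comb _ hZ (@hardy_0 R n)).
rewrite (hardy_dotJ (@hardy_0 R n) hZ) (hardy_dot0l hZ) conjC0 mulr0 h0 /=.
have -> : X - Y = -1 *: Y + X by rewrite addrC scaleN1r.
rewrite (sqnorm_comb (-1) hY hX) (sqnorm_comb 1 hY hX).
have s1 : sqmod (1 : R[i]) = 1 by rewrite sqmodE /= expr1n expr0n addr0.
have s2 : sqmod (2^-1 : R[i]) = 4^-1.
  apply: (mulIf (x := sqmod 2)).
    by apply/eqP => /sqmod_eq0/eqP; rewrite pnatr_eq0.
  rewrite -sqmodM mulVf ?pnatr_eq0// s1.
  have -> : (2 : R[i]) = 2%:C%C by rewrite rmorphD rmorph1.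
  by rewrite sqmodE /= expr0n addr0; field.
rewrite sqmodN s1 s2 mulN1r mul1r.
case: (hardy_dot Y X) => u v /=.
by move: (sqnorm X) (sqnorm Y) => x y; field.
Qed.

Lemma le_cvg0 (R : realType) (e : nat -> R) (x C : R) :
  e @ \oo --> (0 : R) -> (forall p, x <= C * e p) -> x <= 0.
Proof.
move=> e0 xe; rewrite -(mulr0 C).
apply: (ler_cvg_to (cvg_cst x) (cvgM (cvg_cst C) e0)).
by near=> p; exact: xe.
Unshelve. all: by end_near.
Qed.

Lemma sqmod_dotC (R : realType) n (F G : disc R -> 'cV[R[i]]_n) :
  hardy n F -> hardy n G -> sqmod (hardy_dot F G) = sqmod (hardy_dot G F).
Proof. by move=> hF hG; rewrite (hardy_dotJ hG hF) sqmodJ. Qed.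

Lemma weighted_sum_le (R : realType) (a b k l N c : R) : c = 2 * l ->
  a <= N * c * k -> b <= l * k -> 2 * a + 2 * b <= (2 * N + 1) * k * c.
Proof. by move=> -> ? ?; lra. Qed.

(** The component [w] is the element [H] of least norm in the affine space [A]
    of functions of [M] with the same value at 0 as [F]. *)
Lemma orth_decomp (R : realType) n (M : set (disc R -> 'cV[R[i]]_n)) F :
  closed_subspace M -> M F ->
  exists w g, [/\ ominus M (M `&` zhardy n) w, M g, g disc0 = 0 & F = w + g].
Proof.
move=> [sM cM] MF; have [hM M0 MD] := sM.
pose A := [set G | M G /\ G disc0 = F disc0].
pose E := [set sqnorm G | G in A].
have lbE : has_lbound E by exists 0 => _ [G [/hM hG _] <-]; exact: sqnorm_ge0.
have infE : has_inf E by split=> //; exists (sqnorm F), F.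
pose d := inf E.
have dA G : A G -> d <= sqnorm G by move=> AG; apply: ge_inf => //; exists G.
pose e p : R := 2 * harmonic p.
have e0 : e @ \oo --> (0 : R).
  by rewrite -(mulr0 2); apply: cvgM; [exact: cvg_cst|exact: cvg_harmonic].
have /choice[G hG] : forall p, exists G, A G /\ sqnorm G <= d + harmonic p.
  move=> p; have hp : 0 < harmonic p :> R by rewrite /harmonic /= invr_gt0.
  by have [_ [G AG <-] /ltW lt] := inf_adherent hp infE; exists G.
have AG p : A (G p) := (hG p).1.
have hardyG p : hardy n (G p) by apply: hM; have [] := AG p.
have eG p q : sqnorm (G p - G q) <= e p + e q.
  have := sqnorm_parallelogram (hardyG p) (hardyG q).
  (* Midpoints stay in [A], so their squared norms are at least [d]. *)
  set Z := 2^-1 *: _; have AZ : A Z.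
    split.
      rewrite /Z -[_ *: _]addr0; apply: (MD); last exact: M0.
      by apply: (MD); [exact: (AG q).1|exact: (AG p).1].
    rewrite /Z scale1r; have ev :
      (2^-1 *: (G q + G p)) disc0 = 2^-1 *: (G q disc0 + G p disc0) by [].
    rewrite ev (AG p).2 (AG q).2 scalerDr -scalerDl.
    have -> : 2^-1 + 2^-1 = 1 :> R[i] by field.
    by rewrite scale1r.
  have := dA _ AZ; have := (hG p).2; have := (hG q).2; rewrite /e.
  move: (sqnorm _) (sqnorm _) (sqnorm _) (sqnorm _) => a b c s.
  by move: (harmonic p) (harmonic q) => k l; lra.
have [H hH HG] := hardy_complete hardyG e0 eG.
have MH : M H.
  apply: cM => // t t0; have t2 : 0 < t ^+ 2 by rewrite exprn_gt0.
  have [p ep] : exists p, n%:R * e p < t ^+ 2.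
    apply: contrapT => nep.
    have : t ^+ 2 <= 0.
      apply: (@le_cvg0 _ e _ n%:R e0) => p; rewrite leNgt; apply/negP => h.
      by apply: nep; exists p.
    by rewrite leNgt t2.
  exists (G p); first by have [] := AG p.
  rewrite (hardy_normE (hardyB hH (hardyG p))) -[ltRHS]ger0_norm ?ltW// -sqrtr_sqr.
  by rewrite ltr_sqrt//; exact: le_lt_trans (HG p) ep.
have H0 : H disc0 = F disc0.
  apply/colP => j; apply/eqP; rewrite -subr_eq0; apply/eqP/sqmod_eq0.
  apply/eqP; rewrite eq_le sqmod_ge0 andbT.
  apply: (@le_cvg0 _ e _ n%:R e0) => p.
  have := sqmod_disc0_le j (hardyB hH (hardyG p)) => /le_trans/(_ (HG p)).
  have -> : (H - G p) disc0 = H disc0 - G p disc0 by [].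
  by rewrite (AG p).2 !mxE.
exists H, (F - H); split.
- split=> // K [MK zK]; have hK := hM _ MK.
  have K0 : K disc0 = 0 by apply/(zhardyP hK).
  suff : sqmod (hardy_dot H K) <= 0.
    move=> s0; apply: sqmod_eq0; apply/eqP; by rewrite eq_le s0 sqmod_ge0.
  apply: (@le_cvg0 _ e _ ((2 * n%:R + 1) * sqnorm K) e0) => p.
  have h1 : sqmod (hardy_dot (H - G p) K) <= n%:R * e p * sqnorm K.
    have hB := hardyB hH (hardyG p).
    rewrite (sqmod_dotC hB hK); apply: le_trans (cauchy_schwarz hK hB) _.
    by rewrite ler_wpM2r ?(sqnorm_ge0 hK).
  have h2 : sqmod (hardy_dot (G p) K) <= harmonic p * sqnorm K.
    rewrite (sqmod_dotC (hardyG p) hK).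
    apply: (@le_trans _ _ ((sqnorm (G p) - d) * sqnorm K)).
      apply: (sqmod_dot_le hK (hardyG p) (dA _ (AG p))).
      move=> c; apply: dA; split; first exact: MD MK (AG p).1.
      have -> : (c *: K + G p) disc0 = c *: K disc0 + G p disc0 by [].
      by rewrite K0 scaler0 add0r (AG p).2.
    by rewrite ler_wpM2r ?(sqnorm_ge0 hK)// lerBlDl (hG p).2.
  have -> : hardy_dot H K = hardy_dot (H - G p) K + hardy_dot (G p) K.
    by rewrite (hardy_dotBl hH (hardyG p) hK) subrK.
  apply: le_trans (sqmodD_le _ _) _.
  exact: weighted_sum_le (erefl (e p)) h1 h2.
- exact: subspaceB.
- by have -> : (F - H) disc0 = F disc0 - H disc0 by []; rewrite H0 subrr.
- by rewrite addrC subrK.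
Qed.

(** * Coordinate projections and the defect space *)

Lemma first_coords_comb (R : realType) n i (hi : (i <= n)%N) c
    (F G : disc R -> 'cV[R[i]]_n) :
  first_coords hi (c *: F + G) = c *: first_coords hi F + first_coords hi G.
Proof.
have e k (A B : disc R -> 'cV[R[i]]_k) z : (c *: A + B) z = c *: A z + B z by [].
by apply/funext => z; apply/colP => j; rewrite e /first_coords e !mxE.
Qed.

Lemma first_coordsD (R : realType) n i (hi : (i <= n)%N)
    (F G : disc R -> 'cV[R[i]]_n) :
  first_coords hi (F + G) = first_coords hi F + first_coords hi G.
Proof. by rewrite -[F]scale1r first_coords_comb !scale1r. Qed.

Lemma first_coords0 (R : realType) n i (hi : (i <= n)%N) :
  first_coords hi (0 : disc R -> 'cV[R[i]]_n) = 0.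
Proof.
by apply: (addrI (first_coords hi 0)); rewrite -first_coordsD !addr0.
Qed.

Lemma first_coords_sum (R : realType) n i (hi : (i <= n)%N) r (c : 'I_r -> R[i])
    (v : 'I_r -> disc R -> 'cV[R[i]]_n) :
  first_coords hi (\sum_(k < r) c k *: v k) = \sum_(k < r) c k *: first_coords hi (v k).
Proof.
apply: (big_rec2 (fun x y => first_coords hi x = y)); first exact: first_coords0.
by move=> k y x _ <-; rewrite first_coords_comb.
Qed.

Lemma hardy_first_coords (R : realType) n i (hi : (i <= n)%N)
    (F : disc R -> 'cV[R[i]]_n) : hardy n F -> hardy i (first_coords hi F).
Proof.
move=> hF j; have -> : entry (first_coords hi F) j = entry F (widen_ord hi j).
  by apply/funext => z; rewrite /entry /first_coords mxE.
exact: hF.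
Qed.

Lemma bshift_first_coords (R : realType) n i (hi : (i <= n)%N)
    (F : disc R -> 'cV[R[i]]_n) :
  hardy n F -> bshift (first_coords hi F) = first_coords hi (bshift F).
Proof.
move=> hF; apply: hardy_eq_off0.
- exact/hardy_bshift/hardy_first_coords.
- exact/hardy_first_coords/hardy_bshift.
move=> z z0; apply/colP => j.
by rewrite /first_coords /bshift (negbTE z0) !mxE.
Qed.

Lemma is_subspace_first_coords (R : realType) n i (hi : (i <= n)%N)
    (M : set (disc R -> 'cV[R[i]]_n)) :
  is_subspace M -> is_subspace (first_coords hi @` M).
Proof.
move=> [hM M0 MD]; split.
- by move=> _ [F MF <-]; apply/hardy_first_coords/hM.
- by exists 0 => //; exact: first_coords0.
move=> c _ _ [F MF <-] [G MG <-]; exists (c *: F + G); first exact: MD.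
exact: first_coords_comb.
Qed.

Lemma is_subspace_sumspace (R : realType) n (M N : set (disc R -> 'cV[R[i]]_n)) :
  is_subspace M -> is_subspace N -> is_subspace (sumspace M N).
Proof.
move=> [hM M0 MD] [hN N0 ND]; split.
- move=> _ [F MF [G NG <-]]; rewrite -[F]scale1r.
  by apply: hardy_comb; [exact: hM|exact: hN].
- by exists 0 => //; exists 0 => //; rewrite addr0.
move=> c _ _ [F MF [G NG <-]] [F' MF' [G' NG' <-]].
exists (c *: F + F'); first exact: MD.
exists (c *: G + G'); first exact: ND.
by rewrite scalerDr addrACA.
Qed.

Lemma lin_span_comb (R : realType) n r (v : 'I_r -> disc R -> 'cV[R[i]]_n) c F G :
  lin_span v F -> lin_span v G -> lin_span v (c *: F + G).
Proof.
move=> [a ->] [b ->]; exists (fun k => c * a k + b k).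
rewrite scaler_sumr -big_split; apply: eq_bigr => k _ /=.
by rewrite scalerDl scalerA.
Qed.

Lemma lin_span0 (R : realType) n r (v : 'I_r -> disc R -> 'cV[R[i]]_n) :
  lin_span v 0.
Proof. by exists (fun=> 0); rewrite big1// => k _; rewrite scale0r. Qed.

Lemma lin_span_mem (R : realType) n r (v : 'I_r -> disc R -> 'cV[R[i]]_n) k :
  lin_span v (v k).
Proof.
exists (fun j => (j == k)%:R); rewrite (bigD1 k)//= eqxx scale1r big1 ?addr0//.
by move=> j /negbTE ->; rewrite scale0r.
Qed.

Lemma is_subspace_divz_hardy (R : realType) n r (v : 'I_r -> disc R -> 'cV[R[i]]_n) :
  is_subspace (divz_hardy (lin_span v)).
Proof.
split.
- by move=> F [].
- split; first exact: hardy_0.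
  exists 0; first exact: lin_span0.
  move=> z _; have e w : (0 : disc R -> 'cV[R[i]]_n) w = 0 by [].
  by rewrite !e scaler0.
move=> c F G [hF [f sf Ff]] [hG [g sg Gg]]; split; first exact: hardy_comb.
exists (c *: f + g); first exact: lin_span_comb.
move=> z z0.
have e (A B : disc R -> 'cV[R[i]]_n) w : (c *: A + B) w = c *: A w + B w by [].
rewrite !e Ff// Gg// scalerDr !scalerA; congr (_ *: _ + _); exact: mulrC.
Qed.

(** The coefficients [a] of [zG] on [v] determine [G] off 0, hence everywhere
    by [hardy_eq_off0]; together with the coefficients [b] on [w] they are
    coordinates for [G + \sum_k b k *: w k]. *)
Lemma dim_le_defect (R : realType) n r m (v : 'I_r -> disc R -> 'cV[R[i]]_n)
    (w : 'I_m -> disc R -> 'cV[R[i]]_n) :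
  dim_le (sumspace (divz_hardy (lin_span v)) (lin_span w)) (r + m).
Proof.
move=> p u Xu iu.
have /choice[g hg] : forall j, exists g : (disc R -> 'cV[R[i]]_n) *
    ('I_r -> R[i]) * ('I_m -> R[i]),
    [/\ hardy n g.1.1,
      forall z, val z != 0 -> g.1.1 z = (val z)^-1 *: (\sum_k g.1.2 k *: v k) z &
      u j = g.1.1 + \sum_k g.2 k *: w k].
  move=> j; have [G [hG [_ [a ->] aG]] [_ [b ->] <-]] := Xu j.
  by exists (G, a, b).
pose A := \matrix_(j < p, k < r) (g j).1.2 k.
pose B := \matrix_(j < p, k < m) (g j).2 k.
apply: (lin_indep_le_coord (A := row_mx A B) iu) => d.
rewrite mul_mx_row -row_mx0 => /eq_row_mx[dA dB].
have zB : \sum_(j < p) d 0 j *: (\sum_k (g j).2 k *: w k) = 0.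
  apply: comb_span_eq0 dB => j; apply: eq_bigr => k _; by rewrite mxE.
have zA : \sum_(j < p) d 0 j *: (\sum_k (g j).1.2 k *: v k) = 0.
  apply: comb_span_eq0 dA => j; apply: eq_bigr => k _; by rewrite mxE.
have zG : \sum_(j < p) d 0 j *: (g j).1.1 = 0.
  have hs : is_subspace (@hardy R n).
    by split; [move=> F|exact: hardy_0|move=> c F G; exact: hardy_comb].
  apply: hardy_eq_off0.
  - have := @subspace_sum _ _ _ _ (fun j => d 0 j) (fun j => (g j).1.1) hs.
    by apply=> j; have [] := hg j.
  - exact: hardy_0.
  move=> z z0; rewrite fct_sumE.
  transitivity ((val z)^-1 *: (\sum_(j < p) d 0 j *: (\sum_k (g j).1.2 k *: v k)) z).
    rewrite fct_sumE scaler_sumr; apply: eq_bigr => j _.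
    have e c (F : disc R -> 'cV[R[i]]_n) x : (c *: F) x = c *: F x by [].
    by have [_ /(_ _ z0) h _] := hg j; rewrite !e h !scalerA mulrC.
  by rewrite zA; exact: scaler0.
transitivity (\sum_(j < p) d 0 j *: (g j).1.1 +
              \sum_(j < p) d 0 j *: (\sum_k (g j).2 k *: w k)).
  rewrite -big_split; apply: eq_bigr => j _ /=.
  by have [_ _ ->] := hg j; rewrite scalerDr.
by rewrite zG zB addr0.
Qed.

Lemma is_subspace_ominus (R : realType) n (M N : set (disc R -> 'cV[R[i]]_n)) :
  is_subspace M -> N `<=` hardy n -> is_subspace (ominus M N).
Proof.
move=> [hM M0 MD] hN; split.
- by move=> F [/hM].
- by split=> // G /hN hG; exact: hardy_dot0l.
move=> c F G [MF oF] [MG oG]; split; first exact: MD.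
move=> K NK; rewrite (hardy_dot_comb c (hM _ MF) (hM _ MG) (hN _ NK)).
by rewrite oF// oG// mulr0 addr0.
Qed.

(** A function of [W] that vanishes at 0 lies in [M `&` zhardy n], hence is
    orthogonal to itself. *)
Lemma ominus_disc0_inj (R : realType) n (M : set (disc R -> 'cV[R[i]]_n)) F :
  M `<=` hardy n -> ominus M (M `&` zhardy n) F -> F disc0 = 0 -> F = 0.
Proof.
move=> hM [MF oF] F0; have hF := hM _ MF; apply: (sqnorm_eq0 hF).
have : hardy_dot F F = 0 by apply: oF; split=> //; apply/(zhardyP hF).
by rewrite (hardy_dot_sqnorm hF) => -[].
Qed.

Lemma dim_le_ominus (R : realType) n (M : set (disc R -> 'cV[R[i]]_n)) :
  is_subspace M -> dim_le (ominus M (M `&` zhardy n)) n.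
Proof.
move=> sM r u Wu iu; have [hM _ _] := sM.
have sW : is_subspace (ominus M (M `&` zhardy n)).
  by apply: is_subspace_ominus => // F [/hM].
apply: (lin_indep_le_coord (A := \matrix_(j, k) u j disc0 k 0) iu) => d dA.
apply: (ominus_disc0_inj hM); first exact: subspace_sum.
rewrite fct_sumE; apply/colP => k; rewrite summxE mxE.
have /rowP/(_ k) := dA; rewrite !mxE => h; rewrite -[RHS]h; apply: eq_bigr => j _.
have e c (F : disc R -> 'cV[R[i]]_n) x : (c *: F) x = c *: F x by [].
by rewrite e !mxE.
Qed.

Theorem theorem3p1 (R : realType) (n m : nat)
    (M D : set (disc R -> 'cV[R[i]]_n))
    (MD : nearly_invariant_defect M m D) :
  let W := ominus M (M `&` zhardy n) in
  (exists (r : nat) (Wb : 'I_r -> (disc R -> 'cV[R[i]]_n)),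
     orthonormal_basis W Wb) /\
  forall (r : nat) (Wb : 'I_r -> (disc R -> 'cV[R[i]]_n)),
    orthonormal_basis W Wb ->
    (r <= n)%N /\
    forall (i : nat) (hi : (i <= n)%N), (0 < i)%N ->
      nearly_invariant_with (first_coords hi @` M)
        (sumspace (divz_hardy (lin_span (fun k => first_coords hi (Wb k))))
                  (first_coords hi @` D)).
Proof.
case: MD => cM sD [d [_ Dd]] _ nM W; have [sM _] := cM; have [hM _ _] := sM.
have sW : is_subspace W by apply: is_subspace_ominus => // F [/hM].
have bW : dim_le W n by exact: dim_le_ominus.
split; first exact: orthonormal_basis_exists bW.
move=> r Wb [oWb eW].
have WWb k : W (Wb k) by rewrite eW; exact: lin_span_mem.
have hW F : W F -> hardy n F by case=> /hM.
split; first by apply: (bW r Wb) => //; apply: orthonormal_indep => // k; exact: hW.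
move=> i hi _.
set E := sumspace _ _.
have sE : is_subspace E.
  apply: is_subspace_sumspace; first exact: is_subspace_divz_hardy.
  exact: is_subspace_first_coords.
split=> //; first exact: is_subspace_first_coords.
  apply: (dim_le_has_dim (k := r + m) sE).
  have PD : first_coords hi @` D = lin_span (fun k => first_coords hi (d k)).
    rewrite Dd; apply/seteqP; split=> [_ [_ [c ->] <-]|_ [c ->]].
      by exists c; exact: first_coords_sum.
    by exists (\sum_(k < m) c k *: d k); [exists c|exact: first_coords_sum].
  by rewrite /E PD; exact: dim_le_defect.
move=> _ [F MF <-] PF0.
have [w [g [Ww Mg g0 Fwg]]] := orth_decomp cM MF.
have hg := hM _ Mg; have hw := hW _ Ww.
have hPw := hardy_first_coords hi hw.
have Pw0 : first_coords hi w disc0 = 0.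
  have Fw : F disc0 = w disc0.
    by rewrite Fwg; have -> : (w + g) disc0 = w disc0 + g disc0 by []; rewrite g0 addr0.
  by rewrite -PF0 /first_coords Fw.
have [x Mx [y Dy xy]] := nM _ Mg g0.
exists (first_coords hi x); first by exists x.
exists (bshift (first_coords hi w) + first_coords hi y); last first.
  rewrite Fwg first_coordsD (bshiftD hPw (hardy_first_coords hi hg)).
  by rewrite (bshift_first_coords hi hg) -xy first_coordsD addrCA.
exists (bshift (first_coords hi w)); last by exists (first_coords hi y) => //; exists y.
split; first exact: hardy_bshift.
exists (first_coords hi w); last by move=> z z0; exact: bshift_off0.
by have : W w := Ww; rewrite eW => -[c ->]; exists c; exact: first_coords_sum.
Qed.
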